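(* Let $\mathbb K$ be a field, let $n$ be a positive integer, and let $d$ be a non-negative integer with $d\leq\frac{n^2+n}{4}$. Let $R$ be a quadratic semigroup algebra over $\mathbb K$ with $n$ generators given by $d$ relations. Then $R$ is infinite dimensional over $\mathbb K$.
   Context: For a set $X$, $\mathbb K\langle X\rangle$ denotes the free associative (unital) algebra over the field $\mathbb K$ generated by $X$. A quadratic semigroup algebra with $n$ generators given by $d$ relations is an algebra of the form $R=\mathbb K\langle X\rangle/I$, where $X=\{x_1,\dots,x_n\}$ is an $n$-element set and $I$ is the two-sided ideal generated by relations $r_1,\dots,r_d\in\mathbb K\langle X\rangle$, each of which is either a degree 2 monomial $x_jx_k$ or a difference $x_jx_k-x_lx_m$ of two degree 2 monomials. The relations form a list; they are not required to be distinct or linearly independent. *)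

(* Defs.v *)
From HB Require Import structures.
From mathcomp Require Import all_boot all_order all_algebra.
From mathcomp Require Import generic_quotient ring_quotient.
From mathcomp Require Import boolp.
From mathcomp.multinomials Require Import monalg.

Set Implicit Arguments.
Unset Strict Implicit.
Unset Printing Implicit Defensive.

Import GRing.Theory.

Local Open Scope ring_scope.
Local Open Scope quotient_scope.

Section FreeAlgebra.
Variables (K : fieldType) (n : nat).

(* K<x_1, ..., x_n>: the algebra of the free monoid on the alphabet 'I_n. *)
Definition free_algebra := {malg K[{fmonom 'I_n}]}.

HB.instance Definition _ := GRing.Lalgebra.on free_algebra.

Fact free_algebra_scalerAr (c : K) (f g : free_algebra) :
  c *: (f * g) = f * (c *: g).
Proof.
suff fc : f * malgC c = malgC c * f.
  by rewrite -!mul_malgC mulrA -fc -mulrA.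
rewrite !malgM_def fgmulgU fgmulUg; apply: eq_bigr => m _.
by rewrite mulm1 mul1m mulrC.
Qed.

(* monalg declares an algType only over commutative monoids, hence the alias *)
HB.instance Definition _ :=
  GRing.Lalgebra_isAlgebra.Build K free_algebra free_algebra_scalerAr.

Definition gen (i : 'I_n) : free_algebra := << fmu i >>.

End FreeAlgebra.

Section QuotientAlgebra.
Variables (K : fieldType) (A : algType K) (S : seq A).

Inductive in_ideal : A -> Prop :=
| in_ideal_gen f : f \in S -> in_ideal f
| in_ideal_0 : in_ideal 0
| in_ideal_add f g : in_ideal f -> in_ideal g -> in_ideal (f + g)
| in_ideal_mull a f : in_ideal f -> in_ideal (a * f)
| in_ideal_mulr a f : in_ideal f -> in_ideal (f * a).

Definition ideal : pred A := fun f => `[< in_ideal f >].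

Fact ideal_zmod_closed : zmod_closed ideal.
Proof.
split=> [|f g /asboolP If /asboolP Ig]; apply/asboolP; first exact: in_ideal_0.
by rewrite -mulN1r; apply/in_ideal_add/in_ideal_mull.
Qed.

HB.instance Definition _ := GRing.isZmodClosed.Build A ideal ideal_zmod_closed.

Lemma idealMl a f : f \in ideal -> a * f \in ideal.
Proof. by move=> /asboolP If; apply/asboolP/in_ideal_mull. Qed.

Lemma idealMr a f : f \in ideal -> f * a \in ideal.
Proof. by move=> /asboolP If; apply/asboolP/in_ideal_mulr. Qed.

Lemma idealZ (c : K) f : f \in ideal -> c *: f \in ideal.
Proof. by move=> If; rewrite -mulr_algl idealMl. Qed.

(* ring_quotient has the underlying group {quot I} for any additive subgroup I,
   but a ring structure on it only when A is commutative. *)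
Definition quotient_algebra :=
  Quotient.quot (GRing.ZmodClosed.clone A ideal _).
Local Notation Q := quotient_algebra.

HB.instance Definition _ := GRing.Zmodule.on Q.
HB.instance Definition _ := EqQuotient.on Q.

Definition quo_proj (f : A) : Q := \pi_Q f.

Lemma quo_projK : cancel (@repr _ _ : Q -> A) quo_proj.
Proof. exact: reprK. Qed.

Lemma quo_projP f g : reflect (quo_proj f = quo_proj g) (f - g \in ideal).
Proof. by rewrite Quotient.idealrBE; apply: eqP. Qed.

Lemma quo_projD : {morph quo_proj : f g / f + g}.
Proof. exact: pi_addr. Qed.

Definition quo_one : Q := quo_proj 1.
Definition quo_mul (x y : Q) : Q := quo_proj (repr x * repr y).
Definition quo_scale (c : K) (x : Q) : Q := quo_proj (c *: repr x).

Lemma quo_mulE f g : quo_mul (quo_proj f) (quo_proj g) = quo_proj (f * g).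
Proof.
apply/quo_projP; set f' := repr _; set g' := repr _.
have If : f' - f \in ideal by apply/quo_projP/quo_projK.
have Ig : g' - g \in ideal by apply/quo_projP/quo_projK.
have -> : f' * g' - f * g = f' * (g' - g) + (f' - f) * g.
  by rewrite mulrBr mulrBl addrA addrNK.
by apply: rpredD; [apply: idealMl | apply: idealMr].
Qed.

Lemma quo_scaleE c f : quo_scale c (quo_proj f) = quo_proj (c *: f).
Proof.
apply/quo_projP; rewrite -scalerBr idealZ //.
exact/quo_projP/quo_projK.
Qed.

Lemma quo_ind (P : Q -> Prop) : (forall f, P (quo_proj f)) -> forall x, P x.
Proof. by move=> Pf x; rewrite -[x]quo_projK. Qed.

Fact quo_mulA : associative quo_mul.
Proof.
elim/quo_ind=> f; elim/quo_ind=> g; elim/quo_ind=> h.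
by rewrite !quo_mulE mulrA.
Qed.

Fact quo_mul1 : left_id quo_one quo_mul.
Proof. by elim/quo_ind=> f; rewrite quo_mulE mul1r. Qed.

Fact quo_mulr1 : right_id quo_one quo_mul.
Proof. by elim/quo_ind=> f; rewrite quo_mulE mulr1. Qed.

Fact quo_mulDl : left_distributive quo_mul +%R.
Proof.
elim/quo_ind=> f; elim/quo_ind=> g; elim/quo_ind=> h.
by rewrite -quo_projD !quo_mulE -quo_projD mulrDl.
Qed.

Fact quo_mulDr : right_distributive quo_mul +%R.
Proof.
elim/quo_ind=> f; elim/quo_ind=> g; elim/quo_ind=> h.
by rewrite -quo_projD !quo_mulE -quo_projD mulrDr.
Qed.

HB.instance Definition _ := GRing.Zmodule_isPzRing.Build Q
  quo_mulA quo_mul1 quo_mulr1 quo_mulDl quo_mulDr.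

Fact quo_scalerA c d x : quo_scale c (quo_scale d x) = quo_scale (c * d) x.
Proof. by elim/quo_ind: x => f; rewrite !quo_scaleE scalerA. Qed.

Fact quo_scale1r : left_id 1 quo_scale.
Proof. by elim/quo_ind=> f; rewrite quo_scaleE scale1r. Qed.

Fact quo_scalerDr : right_distributive quo_scale +%R.
Proof.
move=> c; elim/quo_ind=> f; elim/quo_ind=> g.
by rewrite -quo_projD !quo_scaleE -quo_projD scalerDr.
Qed.

Fact quo_scalerDl x : {morph quo_scale^~ x : c d / c + d}.
Proof.
move=> c d; elim/quo_ind: x => f.
by rewrite !quo_scaleE -quo_projD scalerDl.
Qed.

HB.instance Definition _ := GRing.Zmodule_isLmodule.Build K Q
  quo_scalerA quo_scale1r quo_scalerDr quo_scalerDl.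

(* No algType instance: algType excludes the zero ring, and the ideal generated
   by an arbitrary S need not be proper. *)
Lemma quo_scalerAl (c : K) (x y : Q) : c *: (x * y) = (c *: x) * y.
Proof.
elim/quo_ind: x => f; elim/quo_ind: y => g.
by rewrite /GRing.scale /GRing.mul /= !(quo_scaleE, quo_mulE) scalerAl.
Qed.

Lemma quo_scalerAr (c : K) (x y : Q) : c *: (x * y) = x * (c *: y).
Proof.
elim/quo_ind: x => f; elim/quo_ind: y => g.
by rewrite /GRing.scale /GRing.mul /= !(quo_scaleE, quo_mulE) scalerAr.
Qed.

End QuotientAlgebra.

Section Relations.
Variables (K : fieldType) (n : nat).

Definition semigroup_relation (r : free_algebra K n) : Prop :=
  (exists j k, r = gen K j * gen K k) \/
  (exists j k l m, r = gen K j * gen K k - gen K l * gen K m).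

End Relations.

(* Vector.axiom m V is the type of linear isomorphisms from V to 'rV[K]_m. *)
Definition infinite_dimensional (K : fieldType) (V : lmodType K) : Prop :=
  forall m : nat, ~ inhabited (Vector.axiom m V).

(* Main.v *)
From HB Require Import structures.
Require Import Defs.
From mathcomp Require Import all_boot all_order all_algebra.
From mathcomp Require Import zify.
From mathcomp Require boolp.
From mathcomp.multinomials Require Import monalg.
Import GRing.Theory.

(** The algebra R is infinite dimensional as soon as it has a representation
    in which some word x_i x_j acts as a nonzero idempotent N.  Indeed all the
    relations are homogeneous of degree 2, so a representation x_k |-> M_k over
    an algebra B deforms to x_k |-> M_k X over B[X], where the powers of
    x_i x_j become N X^2, N X^4, and so on, which are linearly independent
    (quadratic_infinite_dimensional).

    It remains to find such a representation when 4 d <= n^2 + n.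

    If no relation is a monomial, x_k |-> 1 respects all the relations.

    If some relation is a monomial, at most 2 d - 1 of the n^2 words of length 2
    occur in the relations, a monomial contributing one word and a difference at
    most two.  More than n (n - 1) / 2 words x_i x_j are thus untouched by the
    relations.  There are only n (n - 1) / 2 unordered pairs of distinct
    indices, so either some x_i x_i is untouched or both x_i x_j and x_j x_i are
    untouched for some i <> j (symmetric_pair_of_card).  No relation can then
    alter the alternating word x_i x_j x_i x_j and its continuations.  This is
    witnessed by 2 x 2 matrices: x_i and x_j act as the two off-diagonal matrix
    units (as their sum if i = j) and the other generators as 0; then all words
    of length 2 but x_i x_j and x_j x_i act as 0.

    Without a monomial relation the count would only give n (n - 1) / 2
    untouched words when 4 d = n^2 + n, and these may all be of the form x_i x_j
    with i < j; hence the separate treatment of that case. *)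

Local Open Scope ring_scope.

(** * Linear independence modulo an ideal *)

Section Quotient.
Context (K : fieldType) (A : algType K) (S : seq A).

Lemma in_ideal_ker (T : nzRingType) (phi : {rmorphism A -> T}) (f : A) :
  (forall s, s \in S -> phi s = 0) -> in_ideal S f -> phi f = 0.
Proof.
move=> phiS; elim=> {f} [f /phiS // | | f g _ IHf _ IHg | a f _ IH | a f _ IH].
- exact: rmorph0.
- by rewrite rmorphD IHf IHg addr0.
- by rewrite rmorphM IH mulr0.
- by rewrite rmorphM IH mul0r.
Qed.

Lemma quo_proj0 : quo_proj S 0 = 0.
Proof. by apply: (addrI (quo_proj S 0)); rewrite -quo_projD !addr0. Qed.

Lemma quo_proj_sum m (c : 'I_m -> K) (e : 'I_m -> A) :
  quo_proj S (\sum_k c k *: e k) = \sum_k c k *: quo_proj S (e k).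
Proof.
rewrite (big_morph _ (@quo_projD _ _ S) quo_proj0).
by apply: eq_bigr => k _; rewrite -quo_scaleE.
Qed.

Lemma quo_proj_eq0 f : quo_proj S f = 0 -> in_ideal S f.
Proof.
by rewrite -quo_proj0 => /quo_projP; rewrite subr0 => /boolp.asboolP.
Qed.

(** In a quotient isomorphic to K^m, the matrix E of the coordinates of
    e 0, ..., e m has m + 1 rows and m columns, and a nonzero row vector c with
    c E = 0 is a dependence relation between the e k modulo the ideal. *)
Lemma independent_mod_ideal_infinite_dimensional (e : nat -> A) :
    (forall m (c : 'I_m -> K),
       in_ideal S (\sum_(k < m) c k *: e k) -> forall k, c k = 0) ->
  infinite_dimensional (quotient_algebra S).
Proof.
move=> e_indep m [[v2r v2r_lin v2r_bij]].
pose v2rL :=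
  GRing.isLinear.Build K (quotient_algebra S) 'rV[K]_m *:%R v2r v2r_lin.
pose phi : {linear quotient_algebra S -> 'rV[K]_m} := HB.pack v2r v2rL.
pose E := \matrix_(k < m.+1) phi (quo_proj S (e k)).
have: kermx E != 0.
  by rewrite kermx_eq0 /row_free neq_ltn ltnS rank_leq_col.
case/rowV0Pn=> c /sub_kermxP cE; case/eqP; apply/rowP=> k; rewrite mxE.
apply: (e_indep _ (c 0)) => {k}; apply: quo_proj_eq0.
apply: (bij_inj v2r_bij); rewrite -[v2r]/(phi : _ -> _) linear0 -cE.
rewrite quo_proj_sum linear_sum mulmx_sum_row.
by apply: eq_bigr => k _; rewrite linearZ rowK.
Qed.

End Quotient.

(** * Representations of free algebras *)

Section FreeEvaluation.
Context (K : fieldType) (n : nat) (T : nzRingType).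

Definition word_prod (v : 'I_n -> T) (w : {fmonom 'I_n}) : T :=
  \prod_(k <- w) v k.

Fact word_prod_mmorphism v : mmorphism (word_prod v).
Proof.
split=> [w1 w2|]; first by rewrite /word_prod fmM big_cat.
by rewrite /word_prod fm1 big_nil.
Qed.

HB.instance Definition _ v :=
  isMultiplicative.Build {fmonom 'I_n} T (word_prod v) (word_prod_mmorphism v).

(** The universal property of the free algebra.  The scalars act through a
    central ring morphism f rather than an algebra structure on T, because the
    case of interest T = {poly B}, for B a K-algebra, has only its B-module
    structure. *)
Lemma free_algebra_universal (f : {rmorphism K -> T}) (v : 'I_n -> T) :
    (forall c t, GRing.comm (f c) t) ->
  exists phi : {rmorphism free_algebra K n -> T},
    (forall c g, phi (c *: g) = f c * phi g) /\ (forall k, phi (gen K k) = v k).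
Proof.
move=> f_comm; pose ev : free_algebra K n -> T := mmap f (word_prod v).
have evA : zmod_morphism ev by move=> g h; rewrite /ev raddfB.
have evM : monoid_morphism ev.
  have [evM ev1] := commr_mmap_is_multiplicative (f := f) (h := word_prod v)
    (fun _ _ _ => f_comm _ _).
  by split.
pose aev := GRing.isZmodMorphism.Build _ _ ev evA.
pose mev := GRing.isMonoidMorphism.Build _ _ ev evM.
pose phi : {rmorphism _ -> _} := HB.pack ev aev mev.
exists phi; split=> [c g | k]; first exact: mmapZ.
rewrite -[phi _]/(mmap _ _ _) /gen mmapU /= rmorph1 mul1r /word_prod fmU.
by rewrite big_seq1.
Qed.

End FreeEvaluation.

(** * Infinite dimension from a homogeneous representation *)

(** The idempotent N = M i * M j survives in all powers of the word x_i x_j, and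
    the degree in the polynomial variable separates these powers. *)
Lemma quadratic_infinite_dimensional (K : fieldType) (n : nat) (B : algType K)
    (S : seq (free_algebra K n)) (M : 'I_n -> B) (i j : 'I_n) :
    (forall s, s \in S ->
       (exists k l, s = gen K k * gen K l /\ M k * M l = 0) \/
       (exists k l k' l', s = gen K k * gen K l - gen K k' * gen K l' /\
          M k * M l = M k' * M l')) ->
    M i * M j != 0 -> M i * M j * (M i * M j) = M i * M j ->
  infinite_dimensional (quotient_algebra S).
Proof.
set N := M i * M j => S_rel N_neq0 NN.
have scal_comm c (p : {poly B}) : GRing.comm ((polyC \o in_alg B) c) p.
  apply/polyP=> k /=; rewrite coefCM coefMC.
  by rewrite mulr_algl mulr_algr.
(* The variable 'X records the length of words. *)
have [phi [phiZ phi_gen]] :=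
  @free_algebra_universal K n {poly B} (polyC \o in_alg B)
     (fun k => (M k)%:P * 'X) scal_comm.
have phi2 k l : phi (gen K k * gen K l) = (M k * M l)%:P * 'X^2.
  rewrite rmorphM !phi_gen -mulrA (mulrA 'X) -(commr_polyX (M l)%:P) polyCM.
  by rewrite !mulrA.
(* The powers start at 1, since N ^+ k is N only for k positive. *)
pose e k := (gen K i * gen K j) ^+ k.+1.
have phie k : phi (e k) = N%:P * 'X^(k.+1.*2).
  rewrite rmorphXn phi2 -/N; elim: k => [|k IHk]; first by rewrite expr1.
  rewrite exprS IHk -mulrA (mulrA 'X^2) -(commr_polyXn N%:P 2).
  by rewrite -(mulrA _ 'X^2) -exprD mulrA -polyCM NN.
apply: (@independent_mod_ideal_infinite_dimensional _ _ _ e) => m c ec k.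
have: phi (\sum_(k < m) c k *: e k) = 0.
  apply: in_ideal_ker ec => s /S_rel[[k1 [l1 [-> M0]]]|].
    by rewrite phi2 M0 mul0r.
  by case=> [k1 [l1 [k2 [l2 [-> M0]]]]]; rewrite rmorphB !phi2 M0 subrr.
move/(congr1 (fun p : {poly B} => p`_(k.+1.*2))).
rewrite rmorph_sum coef_sum coef0 (bigD1 k) //= big1 => [|l l_neq_k].
  rewrite phiZ phie coefCM coefCM coefXn eqxx mulr1 addr0 /= mulr_algl => /eqP.
  by rewrite scaler_eq0 (negPf N_neq0) orbF => /eqP.
rewrite phiZ phie coefCM coefCM coefXn eq_sym (inj_eq double_inj) eqSS.
by rewrite (inj_eq val_inj) (negPf l_neq_k) !mulr0.
Qed.

(** * Words of length 2 untouched by the relations *)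

(** Otherwise F, its transpose and the diagonal would be pairwise disjoint, with
    2 #|F| + n elements in all. *)
Lemma symmetric_pair_of_card (n : nat) (F : {set 'I_n * 'I_n}) :
  (n ^ 2 < 2 * #|F| + n)%N ->
  exists i j, ((i, j) \in F) && ((j, i) \in F).
Proof.
move=> F_big; suff: [exists i, exists j, ((i, j) \in F) && ((j, i) \in F)].
  by case/existsP=> i /existsP[j Fij]; exists i, j.
apply: contraLR F_big; rewrite negb_exists => /forallP noF; rewrite -leqNgt.
have {}noF i j : ~~ [&& (i, j) \in F & (j, i) \in F].
  by have := noF i; rewrite negb_exists => /forallP.
pose swap (p : 'I_n * 'I_n) := (p.2, p.1).
have swapK : involutive swap by case.
pose D := [set (i, i) | i : 'I_n].
have cardD : #|D| = n by rewrite card_imset ?card_ord // => i j [].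
have dis : [disjoint F & swap @: F].
  apply/pred0P=> -[i j] /=; apply/negP=> /andP[Fij /imsetP[[k l] Fkl [ik jl]]].
  by have /negP[] := noF i j; rewrite Fij ik jl.
have disD : [disjoint F :|: swap @: F & D].
  apply/pred0P=> -[i j] /=; apply/negP=> /andP[Fij /imsetP[k _ [ik jk]]].
  subst i j; have /negP[] := noF k k; rewrite andbb.
  by case/setUP: Fij => // /imsetP[[i j] Fij [kj ki]]; rewrite {1}ki kj.
have := max_card (mem (F :|: swap @: F :|: D)).
rewrite !cardsU !disjoint_setI0 // !cards0 cardD.
by rewrite (card_imset _ (inv_inj swapK)) card_prod card_ord !subn0 addnn
  -mul2n mulnn.
Qed.

(** The definition makes sense for i = j too: the matrix of x_i is then the
    permutation matrix of order 2, whose square is 1. *)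
Definition alternating_mx (K : fieldType) {n : nat} (i j k : 'I_n) : 'M[K]_2 :=
  (k == i)%:R *: delta_mx 0 1 + (k == j)%:R *: delta_mx 1 0.

Lemma alternating_mxM (K : fieldType) (n : nat) (i j k l : 'I_n) :
  alternating_mx K i j k * alternating_mx K i j l =
  ((k, l) == (i, j))%:R *: delta_mx 0 0 + ((k, l) == (j, i))%:R *: delta_mx 1 1.
Proof.
rewrite /alternating_mx -mulmxE mulmxDl !mulmxDr -!scalemxAl -!scalemxAr.
rewrite !scalerA !mul_delta_mx_cond /= !mulr0n !mulr1n !scaler0 add0r addr0.
by rewrite -!natrM !mulnb !xpair_eqE.
Qed.

Lemma alternating_mx_idem (K : fieldType) (n : nat) (i j : 'I_n)
    (N := alternating_mx K i j i * alternating_mx K i j j) :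
  N != 0 /\ N * N = N.
Proof.
rewrite /N alternating_mxM eqxx scale1r; split.
  apply/eqP=> /matrixP/(_ 0 0).
  by rewrite !mxE /= mulr0 addr0 => /eqP; rewrite oner_eq0.
rewrite -mulmxE mulmxDl !mulmxDr -!scalemxAl -!scalemxAr !mul_delta_mx_cond /=.
by rewrite !mulr0n !mulr1n !scaler0 addr0 add0r scalerA -natrM mulnb andbb.
Qed.

(** [b] tells whether the relation is a monomial; [T] is the set of the words
    written in it, even when they cancel out, as in x_k x_l - x_k x_l. *)
Definition relation_on {K : fieldType} {n : nat} (r : free_algebra K n)
    (b : bool) (T : {set 'I_n * 'I_n}) : Prop :=
  if b then exists k l, r = gen K k * gen K l /\ T = [set (k, l)]
  else exists k l k' l',
    r = gen K k * gen K l - gen K k' * gen K l' /\ T = [set (k, l); (k', l')].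

Lemma semigroup_relation_on (K : fieldType) (n : nat) (r : free_algebra K n) :
  semigroup_relation r ->
  exists x : bool * {set 'I_n * 'I_n}, relation_on r x.1 x.2.
Proof.
case=> [[k [l rE]] | [k [l [k' [l' rE]]]]].
  by exists (true, [set (k, l)]), k, l.
by exists (false, [set (k, l); (k', l')]), k, l, k', l'.
Qed.

Lemma relation_on_card (K : fieldType) (n : nat) (r : free_algebra K n) b T :
  relation_on r b T -> (#|T| <= 2 - b)%N.
Proof.
case: b => [[k [l [_ ->]]] | [k [l [k' [l' [_ ->]]]]]]; first by rewrite cards1.
by rewrite cards2; case: (_ != _).
Qed.

Lemma card_bigcup_lt_double (I : finType) (d : nat) (T : 'I_d -> {set I}) i0 :
    (forall i, #|T i| <= 2)%N -> (#|T i0| <= 1)%N ->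
  (#|\bigcup_i T i| < 2 * d)%N.
Proof.
move=> T_le2 T_le1; have leU : (#|\bigcup_i T i| <= \sum_i #|T i|)%N.
  elim/big_ind2: _ => [|A a B b leA leB|//]; first by rewrite cards0.
  by apply: leq_trans (leq_add leA leB); rewrite cardsU leq_subr.
apply: leq_ltn_trans leU _; rewrite (bigD1 i0) //=.
have : (\sum_(i | i != i0) #|T i| <= \sum_(i < d | i != i0) 2)%N.
  by apply: leq_sum => i _.
rewrite sum_nat_const cardC1 card_ord => leS.
by apply: leq_ltn_trans (leq_add T_le1 leS) _; have := ltn_ord i0; lia.
Qed.

(** * The bound on the number of relations *)

Theorem theorem1p2 (K : fieldType) (n d : nat) (n_gt0 : (0 < n)%N)
    (d_le : d%:R <= (n ^ 2 + n)%:R / 4%:R :> rat)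
    (r : d.-tuple (free_algebra K n))
    (r_rel : forall i : 'I_d, semigroup_relation (tnth r i)) :
  infinite_dimensional (quotient_algebra r).
Proof.
have {}d_le : (4 * d <= n ^ 2 + n)%N.
  move: d_le; rewrite Num.Theory.ler_pdivlMr // -natrM Num.Theory.ler_nat.
  by rewrite mulnC.
have [bT bT_rel] :=
  fin_all_exists (fun i => semigroup_relation_on _ _ _ (r_rel i)).
have [/existsP[i0 bi0] | /existsPn no_monomial] := boolP [exists i, (bT i).1];
  last first.
  pose x0 := Ordinal n_gt0.
  (* The algebra of matrices stands for any nonzero algebra here. *)
  apply: (@quadratic_infinite_dimensional K n 'M[K]_2 r (fun=> 1) x0 x0).
  - move=> _ /tnthP[i ->]; right; have := bT_rel i.
    rewrite (negPf (no_monomial i)).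
    by case=> k [l [k' [l' [-> _]]]]; exists k, l, k', l'.
  - by rewrite mulr1 oner_neq0.
  - by rewrite !mulr1.
pose P := \bigcup_i (bT i).2.
have cardP : (#|P| < 2 * d)%N.
  apply: (@card_bigcup_lt_double _ _ _ i0) => [i|].
    by apply: leq_trans (relation_on_card _ _ _ _ _ (bT_rel i)) (leq_subr _ _).
  by have := relation_on_card _ _ _ _ _ (bT_rel i0); rewrite bi0.
have [i [j /andP[ij ji]]] :
    exists i j, ((i, j) \in ~: P) && ((j, i) \in ~: P).
  apply: symmetric_pair_of_card.
  by have := cardsC P; rewrite card_prod card_ord mulnn; lia.
have M0 t k l : (k, l) \in (bT t).2 ->
    alternating_mx K i j k * alternating_mx K i j l = 0.
  move=> klT; have klP : (k, l) \in P by apply/bigcupP; exists t.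
  rewrite alternating_mxM.
  case: eqP => [kl | _]; first by move: ij; rewrite inE -kl klP.
  case: eqP => [kl | _]; first by move: ji; rewrite inE -kl klP.
  by rewrite !scale0r addr0.
have [N_neq0 NN] := alternating_mx_idem K n i j.
apply: (@quadratic_infinite_dimensional K n 'M[K]_2 r
          (alternating_mx K i j) i j) => // _ /tnthP[t ->].
have := bT_rel t; have := M0 t.
case: (bT t).1 => M0t [k [l]].
  by case=> -> TE; left; exists k, l; rewrite M0t // TE set11.
case=> k' [l' [-> TE]]; right; exists k, l, k', l'.
by rewrite !M0t // TE !inE eqxx ?orbT.
Qed.
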